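(* Let $(X,\Sigma_X,\mu)$ and $(Y,\Sigma_Y,\nu)$ be measure spaces such that $(\mu,\nu)$ is an abelian pair of measures, $\mu(X)>0$ and $\nu(Y)>0$. Then the following statements are equivalent: (a) $\mu\otimes\nu$ is semi-finite; (b) $\mu$ and $\nu$ are semi-finite.
   Context: No finiteness or $\sigma$-finiteness assumptions are made on the measures. $\Sigma_X\otimes\Sigma_Y$ denotes the $\sigma$-algebra on $X\times Y$ generated by the measurable rectangles $E\times F$ with $E\in\Sigma_X$, $F\in\Sigma_Y$. For $A\subseteq X\times Y$, write $A^y=\{x\in X\mid (x,y)\in A\}$ and $A_x=\{y\in Y\mid (x,y)\in A\}$. The pair $(\mu,\nu)$ is called abelian if for every $A\in\Sigma_X\otimes\Sigma_Y$: (i) $y\mapsto\mu(A^y)$ is $\Sigma_Y$-measurable; (ii) $x\mapsto\nu(A_x)$ is $\Sigma_X$-measurable; (iii) $\int_Y\mu(A^y)\,d\nu(y)=\int_X\nu(A_x)\,d\mu(x)$ (as elements of $[0,+\infty]$). For an abelian pair $(\mu,\nu)$ the product measure $\mu\otimes\nu$ on $\Sigma_X\otimes\Sigma_Y$ is defined by $(\mu\otimes\nu)(A)=\int_X\nu(A_x)\,d\mu(x)=\int_Y\mu(A^y)\,d\nu(y)$; it is a measure. A measure $\rho$ on a measurable space $(\Omega,\Sigma_\Omega)$ is semi-finite if for every $A\in\Sigma_\Omega$ with $\rho(A)>0$ there exists $B\subseteq A$ with $B\in\Sigma_\Omega$ and $0<\rho(B)<\infty$. *)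

(* Defs.v *)
From mathcomp Require Import all_boot all_order all_algebra.
From mathcomp Require Import all_classical all_reals all_analysis.
From mathcomp Require Import measurable_realfun.

Set Implicit Arguments.
Unset Strict Implicit.
Unset Printing Implicit Defensive.

Local Open Scope classical_set_scope.
Local Open Scope ring_scope.
Local Open Scope ereal_scope.

Definition abelian_pair (d1 d2 : measure_display) (X : measurableType d1)
    (Y : measurableType d2) (R : realType)
    (mu : {measure set X -> \bar R}) (nu : {measure set Y -> \bar R}) : Prop :=
  forall A : set (X * Y), measurable A ->
    [/\ measurable_fun [set: Y] (fun y => mu (ysection A y)),
        measurable_fun [set: X] (fun x => nu (xsection A x)) &
        \int[nu]_y mu (ysection A y) = \int[mu]_x nu (xsection A x)].

(* [rho] is a bare set function, as in the library's [sigma_finite]: the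
   product [mu \x nu] of two arbitrary measures has no canonical measure
   structure, since the library requires [nu] to be sigma-finite. *)
Definition semi_finite (d : measure_display) (T : measurableType d)
    (R : realType) (rho : set T -> \bar R) : Prop :=
  forall A : set T, measurable A -> 0 < rho A ->
    exists B : set T, [/\ B `<=` A, measurable B & 0 < rho B < +oo].

(* Main.v *)
(** Semi-finiteness of the product passes to a factor because a measurable set
    of finite positive product measure inside [A `*` setT] has a section of
    finite positive measure. Conversely, given [A] of positive product measure,
    shrink to a set [E] of finite positive measure on which [x |-> nu (A_x)] is
    positive; exchanging the integrals, shrink to a set [F] of finite positive
    measure on which [y |-> mu (A^y `&` E)] is positive. Then [A `&` (E `*` F)]
    has positive measure, at most [mu E * nu F]. *)
Require Import Defs.
From mathcomp Require Import all_boot all_order all_algebra.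
From mathcomp Require Import all_classical all_reals all_analysis.
From mathcomp Require Import measurable_realfun.

Import Order.TTheory.

Local Open Scope classical_set_scope.
Local Open Scope ring_scope.
Local Open Scope ereal_scope.

(** A nonnegative function has zero integral exactly when it vanishes almost everywhere, that is,
    when its positivity set is null; both sides are negated here. *)
Lemma integral_gt0E (d : measure_display) (T : measurableType d) (R : realType)
    (mu : {measure set T -> \bar R}) (D : set T) (f : T -> \bar R) :
  measurable D -> measurable_fun D f -> (forall x, 0 <= f x) ->
  (0 < \int[mu]_(x in D) f x) = (0 < mu (D `&` [set x | 0 < f x])).
Proof.
move=> mD mf f0; have mE : measurable (D `&` [set x | 0 < f x]).
  exact: emeasurable_fun_o_infty.
rewrite !lt0e integral_ge0// measure_ge0 !andbT; congr (~~ _).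
have -> : \int[mu]_(x in D) f x = \int[mu]_(x in D) `|f x|.
  by apply: eq_integral => x _; rewrite gee0_abs.
have NE : ~` [set x | D x -> f x = 0] = D `&` [set x | 0 < f x].
  apply/seteqP; split => [x /= /not_implyP[Dx /eqP fx0]|x /= [Dx fx0] /(_ Dx)].
    by rewrite lt0e fx0 f0.
  by move=> fx; rewrite fx ltxx in fx0.
have aeE : ae_eq mu D f (cst 0) <-> mu (D `&` [set x | 0 < f x]) = 0.
  by rewrite -negligibleP// -NE.
apply/eqP/eqP => [/(ae_eq_integral_abs mu mD mf)/aeE//|/aeE].
by move/(ae_eq_integral_abs mu mD mf).
Qed.

(** A finite integral forces [f] to be finite almost everywhere. If [f] took only the values 0 and
    [+oo], its positivity set would then be null, making the integral zero. *)
Lemma integral_gt0_lty_ex (d : measure_display) (T : measurableType d)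
    (R : realType) (mu : {measure set T -> \bar R}) (f : T -> \bar R) :
  measurable_fun setT f -> (forall x, 0 <= f x) ->
  0 < \int[mu]_x f x < +oo -> exists x, 0 < f x < +oo.
Proof.
move=> mf f0 /andP[+ intfoo]; rewrite integral_gt0E// setTI.
have mE : measurable [set x | 0 < f x].
  by rewrite -[X in measurable X]setTI; exact: emeasurable_fun_o_infty.
have /integrable_ae : mu.-integrable setT f.
  apply/integrableP; split => //.
  by under eq_integral do rewrite gee0_abs//.
move=> /(_ measurableT) aefin; apply: contraPP => /forallNP nf.
apply/negP; rewrite -leNgt measure_le0; apply/eqP/(negligibleP mu mE).
apply: negligibleS aefin => x /= fx0 /(_ I) /fin_numPlt/andP[_ fxoo].
by apply: (nf x); rewrite fx0.
Qed.

Section rectangle_sections.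
Context (d1 d2 : measure_display) (X : measurableType d1)
  (Y : measurableType d2) (R : realType).
Variables (mu : {measure set X -> \bar R}) (nu : {measure set Y -> \bar R}).

Lemma integral_xsectionIX (A : set (X * Y)) (E : set X) (F : set Y) :
  \int[mu]_x nu (xsection (A `&` E `*` F) x) =
  \int[mu]_(x in E) nu (xsection A x `&` F).
Proof.
rewrite [RHS]integral_mkcond; apply: eq_integral => x _; rewrite patchE xsectionI.
case: ifPn => xE; first by rewrite in_xsectionX.
by rewrite notin_xsectionX// setI0 measure0.
Qed.

Lemma integral_ysectionIX (A : set (X * Y)) (E : set X) (F : set Y) :
  \int[nu]_y mu (ysection (A `&` E `*` F) y) =
  \int[nu]_(y in F) mu (ysection A y `&` E).
Proof.
rewrite [RHS]integral_mkcond; apply: eq_integral => y _; rewrite patchE ysectionI.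
case: ifPn => yF; first by rewrite in_ysectionX.
by rewrite notin_ysectionX// setI0 measure0.
Qed.

Lemma product_measure1X (E : set X) (F : set Y) : measurable E ->
  (mu \x nu) (E `*` F) = nu F * mu E.
Proof.
move=> mE; rewrite -[E `*` F]setTI /product_measure1/= integral_xsectionIX.
under eq_integral do rewrite xsectionE preimage_setT setTI.
by rewrite integral_cst.
Qed.

End rectangle_sections.

Section abelian_pair.
Context (d1 d2 : measure_display) (X : measurableType d1)
  (Y : measurableType d2) (R : realType).
Variables (mu : {measure set X -> \bar R}) (nu : {measure set Y -> \bar R}).
Hypothesis hab : abelian_pair mu nu.

(** Positivity of [nu setT] gives the cylinder [A]*[setT] positive product measure, possibly
    infinite. *)
Lemma semi_finite_product_fst :
  0 < nu setT -> semi_finite (mu \x nu) -> semi_finite mu.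
Proof.
move=> hY sf A mA A0.
have [||B [BA mB]] := sf (A `*` setT); first exact: measurableX.
  by rewrite product_measure1X// mule_gt0.
have [mmu _ eqI] := hab _ mB.
(* [mu \x nu] unfolds to an integral of [nu] over x-sections; a subset of [X] requires y-sections,
   hence the exchange. *)
rewrite /product_measure1/= -eqI => /integral_gt0_lty_ex[]// y hy.
exists (ysection B y); split => //; last exact: measurable_ysection.
by move=> x /ysectionP /BA[].
Qed.

Lemma semi_finite_product_snd :
  0 < mu setT -> semi_finite (mu \x nu) -> semi_finite nu.
Proof.
move=> hX sf A mA A0.
have [||B [BA mB]] := sf (setT `*` A); first exact: measurableX.
  by rewrite product_measure1X// mule_gt0.
have [_ mnu _] := hab _ mB.
rewrite /product_measure1/= => /integral_gt0_lty_ex[]// x hx.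
exists (xsection B x); split => //; last exact: measurable_xsection.
by move=> y /xsectionP /BA[].
Qed.

Lemma semi_finite_product :
  semi_finite mu -> semi_finite nu -> semi_finite (mu \x nu).
Proof.
move=> sfmu sfnu A mA; rewrite /product_measure1/=.
have [_ mnu _] := hab _ mA.
rewrite integral_gt0E// setTI => /sfmu[|E [EA mE /andP[E0 Eoo]]].
  by rewrite -[X in measurable X]setTI; exact: emeasurable_fun_o_infty.
(* The exchange holds for [mu] on all of [X], so restriction to [E] is obtained by cutting [A] with
   the strip [E]*[setT]. *)
have mAE : measurable (A `&` E `*` setT).
  by apply: measurableI => //; exact: measurableX.
have [mmuE _ eqE] := hab _ mAE.
have muE y : mu (ysection (A `&` E `*` setT) y) = mu (ysection A y `&` E).
  by rewrite ysectionI in_ysectionX// in_setT.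
have {}mmuE : measurable_fun setT (fun y => mu (ysection A y `&` E)).
  by apply: eq_measurable_fun mmuE => y _; rewrite muE.
have : 0 < \int[nu]_y mu (ysection A y `&` E).
  under eq_integral do rewrite -muE.
  rewrite eqE integral_xsectionIX; under eq_integral do rewrite setIT.
  rewrite integral_gt0E//; last exact: measurable_funTS.
  (* By the choice of [E], the sections of [A] over [E] all have positive measure. *)
  by rewrite (_ : _ `&` _ = E)//; exact/setIidl.
rewrite integral_gt0E// setTI => /sfnu[|F [FA mF /andP[F0 Foo]]].
  by rewrite -[X in measurable X]setTI; exact: emeasurable_fun_o_infty.
have mAEF : measurable (A `&` E `*` F).
  by apply: measurableI => //; exact: measurableX.
have mmuEF : measurable_fun F (fun y => mu (ysection A y `&` E)).
  exact: measurable_funTS.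
exists (A `&` E `*` F); split => //.
(* A second exchange makes the integrand [mu (ysection A y]&[E)] over [F]: it is positive there by
   the choice of [F], and at most [mu E]. *)
have [_ _ <-] := hab _ mAEF.
rewrite integral_ysectionIX integral_gt0E//.
rewrite (_ : _ `&` _ = F) ?F0/=; last exact/setIidl.
apply: (@le_lt_trans _ _ (mu E * nu F)).
  rewrite -integral_cst//; apply: ge0_le_integral => // y Fy /=.
  apply: le_measure; rewrite ?inE//.
  by apply: measurableI => //; exact: measurable_ysection.
by apply: lte_mul_pinfty => //; rewrite ge0_fin_numE.
Qed.

End abelian_pair.

Theorem theorem4p2 (d1 d2 : measure_display) (X : measurableType d1)
    (Y : measurableType d2) (R : realType)
    (mu : {measure set X -> \bar R}) (nu : {measure set Y -> \bar R})
    (hab : abelian_pair mu nu) (hX : 0 < mu [set: X]) (hY : 0 < nu [set: Y]) :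
  semi_finite (mu \x nu) <-> semi_finite mu /\ semi_finite nu.
Proof.
split=> [sf|[sfmu sfnu]]; last exact: semi_finite_product.
split; first exact: (semi_finite_product_fst _ _ _ _ _ _ _ hab hY sf).
exact: (semi_finite_product_snd _ _ _ _ _ _ _ hab hX sf).
Qed.
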